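(* Let $G$ be a locally compact (not necessarily Hausdorff) groupoid with Hausdorff unit space $G^0$ and open range and source maps $r,s\colon G\to G^0$. Then the space $\mathfrak{H}G$ carries the structure of a locally compact Hausdorff (topological) groupoid such that the unit space $(\mathfrak{H}G)^0$ is the closure of $G^0$ in $\mathfrak{H}G$ and the range map $\mathfrak{r}$, the source map $\mathfrak{s}$, the multiplication $\mathfrak{m}$ and the inversion $\mathfrak{i}$ are given by $$\mathfrak{r}(A)=AA^{-1},\qquad \mathfrak{s}(A)=A^{-1}A,\qquad \mathfrak{m}((A,B))=AB,\qquad \mathfrak{i}(A)=A^{-1}$$ for all $A,B\in\mathfrak{H}G$ (where, for $\mathfrak{m}$, the pair $(A,B)$ is composable, i.e. $\mathfrak{s}(A)=\mathfrak{r}(B)$).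
   Context: Topological spaces are not assumed Hausdorff. A subset is quasi-compact if every open cover of it has a finite subcover, and compact if it is quasi-compact and Hausdorff. A space $X$ is locally compact if every point has a compact neighbourhood. For a net $(x_\nu)_\nu$ in $X$, $\lim_\nu x_\nu$ denotes the set of all its limit points; the net is primitive if every cluster point is a limit point. For a locally compact space $X$, the Fell compactification $\mathfrak{K}X$ is the set of all limit sets of primitive nets in $X$, with the topology generated by the subbasis of all sets $\mathcal{U}_V=\{A\in\mathfrak{K}X\mid A\cap V\neq\emptyset\}$ ($V\subseteq X$ open) and $\mathcal{U}^Q=\{A\in\mathfrak{K}X\mid A\cap Q=\emptyset\}$ ($Q\subseteq X$ quasi-compact). Put $\mathfrak{H}X=\mathfrak{K}X\setminus\{\emptyset\}$ with the subspace topology (if $X$ is quasi-compact then $\emptyset\notin\mathfrak{K}X$ and $\mathfrak{H}X=\mathfrak{K}X$). The set $X$ is regarded as a subset of $\mathfrak{H}X$ via $x\mapsto\{x\}$ (this map need not be continuous). A locally compact groupoid is a topological groupoid (multiplication and inversion continuous) whose underlying space is locally compact, i.e. every point has a compact (quasi-compact and Hausdorff) neighbourhood; $G^0\subseteq G$ is its unit space. For subsets $A,B\subseteq G$, $A^{-1}=\{x^{-1}\mid x\in A\}$ and $AB=\{xy\mid x\in A,\ y\in B,\ s(x)=r(y)\}$. *)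

(* Defs.v *)
From HB Require Import structures.
From mathcomp Require Import all_boot all_order.
From mathcomp Require Import all_classical topology.

Set Implicit Arguments.
Unset Strict Implicit.
Unset Printing Implicit Defensive.

Local Open Scope classical_set_scope.

(* Throughout, quasi-compactness is the library's [cover_compact], and the
   subspace topology of [A : set X] is the library's topology on [set_type A]. *)

Definition compact_hausdorff (X : topologicalType) (K : set X) : Prop :=
  cover_compact K /\ hausdorff_space (set_type K).

(* The library's [locally_compact] is stated with [precompact], i.e. with
   closures of neighbourhoods, which is not the right notion for
   non-Hausdorff spaces. *)
Definition locally_compact_space (X : topologicalType) : Prop :=
  forall x : X, exists2 K : set X, nbhs x K & compact_hausdorff K.

Record net (X : Type) := Net {
  net_index : Type;
  net_le : net_index -> net_index -> Prop;
  net_inhabited : inhabited net_index;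
  net_le_refl : forall i, net_le i i;
  net_le_trans : forall i j k, net_le i j -> net_le j k -> net_le i k;
  net_directed : forall i j, exists k, net_le i k /\ net_le j k;
  net_val :> net_index -> X }.

Section Nets.
Context {X : topologicalType}.
Implicit Type x : net X.

Definition net_lim x : set X :=
  [set p | forall U, nbhs p U ->
     exists i, forall j, net_le i j -> U (x j)].

Definition net_cluster x : set X :=
  [set p | forall U, nbhs p U ->
     forall i, exists2 j, net_le i j & U (x j)].

Definition primitive_net x : Prop := net_cluster x `<=` net_lim x.

End Nets.

Record fellK (X : topologicalType) := FellK {
  fell_set :> set X;
  fell_setP : exists2 x : net X, primitive_net x & fell_set = net_lim x }.

Definition fell_subbase (X : topologicalType) : set (set (fellK X)) :=
  [set W | exists2 V : set X, open V & W = [set A : fellK X | A `&` V !=set0]] `|`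
  [set W | exists2 Q : set X, cover_compact Q & W = [set A : fellK X | A `&` Q = set0]].

HB.instance Definition _ (X : topologicalType) := gen_eqMixin (fellK X).
HB.instance Definition _ (X : topologicalType) := gen_choiceMixin (fellK X).
HB.instance Definition _ (X : topologicalType) :=
  @isSubBaseTopological.Build (fellK X)
    (set (fellK X)) (@fell_subbase X) id.

Definition fellH (X : topologicalType) : topologicalType :=
  set_type [set A : fellK X | A !=set0].

Definition fellH_set (X : topologicalType) (A : fellH X) : set X :=
  fell_set (set_val A).

Section Points.
Context {X : topologicalType} (lcX : locally_compact_space X).

Let cst_net (x : X) : net X :=
  @Net X unit (fun _ _ => True) (inhabits tt) (fun _ => I)
    (fun _ _ _ _ _ => I)
    (fun _ _ => ex_intro _ tt (conj I I)) (fun _ => x).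

Lemma locally_compact_nbhs_point (x y : X) :
  (forall U, nbhs y U -> U x) -> x = y.
Proof.
move=> yx; have [K nK [_ hK]] := lcX y.
have Ky : K y := nbhs_singleton nK.
have Kx : K x := yx _ nK.
pose x' : set_type K := SigSub (mem_set Kx).
pose y' : set_type K := SigSub (mem_set Ky).
suff /(congr1 set_val) : y' = x' by [].
apply: hK => A B [_ [[V oV <-] /= Vy] VA] nB.
exists x'; split; last exact: nbhs_singleton nB.
by apply: VA; rewrite /= set_valE /=; apply: yx; rewrite nbhsE; exists V.
Qed.

Lemma fell_set_pointP (x : X) :
  exists2 z : net X, primitive_net z & [set x] = net_lim z.
Proof.
exists (cst_net x) => [p px U nU|].
  by exists tt => j _; have [] := px U nU tt.
apply/seteqP; split=> [p -> U nU|p px].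
  by exists tt => j _; exact: nbhs_singleton nU.
apply/esym/locally_compact_nbhs_point => U nU.
by have [i /(_ i I)] := px U nU.
Qed.

Definition fellK_point (x : X) : fellK X := FellK (fell_set_pointP x).

Lemma fellK_point_neq0 (x : X) :
  [set A : fellK X | A !=set0] (fellK_point x).
Proof. by exists x. Qed.

Definition fellH_point (x : X) : fellH X := SigSub (mem_set (fellK_point_neq0 x)).

End Points.

(* [gmul] is a total function, but only its values on composable pairs matter. *)
Record groupoid (G : Type) := Groupoid {
  gunits : set G;
  grng : G -> set_type gunits;
  gsrc : G -> set_type gunits;
  gmul : G -> G -> G;
  ginv : G -> G;
  grng_unit : forall u : set_type gunits, grng (set_val u) = u;
  gsrc_unit : forall u : set_type gunits, gsrc (set_val u) = u;
  grng_mul : forall x y, gsrc x = grng y -> grng (gmul x y) = grng x;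
  gsrc_mul : forall x y, gsrc x = grng y -> gsrc (gmul x y) = gsrc y;
  gmulA : forall x y z, gsrc x = grng y -> gsrc y = grng z ->
    gmul x (gmul y z) = gmul (gmul x y) z;
  gmul_rngl : forall x, gmul (set_val (grng x)) x = x;
  gmul_srcr : forall x, gmul x (set_val (gsrc x)) = x;
  grng_inv : forall x, grng (ginv x) = gsrc x;
  gsrc_inv : forall x, gsrc (ginv x) = grng x;
  gmul_invr : forall x, gmul x (ginv x) = set_val (grng x);
  gmul_invl : forall x, gmul (ginv x) x = set_val (gsrc x) }.

Definition composable (G : Type) (g : groupoid G) : set (G * G) :=
  [set p | gsrc g p.1 = grng g p.2].

(* Continuity of range and source is automatic, since [grng x = x x^-1] and
   [gsrc x = x^-1 x]. *)
Definition topological_groupoid (G : topologicalType) (g : groupoid G) : Prop :=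
  {within composable g, continuous (fun p : G * G => gmul g p.1 p.2)} /\
  continuous (ginv g).

Definition open_map (X Y : topologicalType) (f : X -> Y) : Prop :=
  forall U : set X, open U -> open (f @` U).

Section SetOperations.
Context {G : Type} (g : groupoid G).

Definition set_inv (A : set G) : set G := ginv g @` A.

Definition set_mul (A B : set G) : set G :=
  [set z | exists x y,
     [/\ A x, B y, gsrc g x = grng g y & z = gmul g x y]].

End SetOperations.

(* Main.v *)
Require Import Defs.
From HB Require Import structures.
From mathcomp Require Import all_boot all_order finmap.
From mathcomp Require Import all_classical topology.

Set Implicit Arguments.
Unset Strict Implicit.
Unset Printing Implicit Defensive.

Local Open Scope classical_set_scope.

(** Every primitive net refines to an ultrafilter with the same limit set, and
    the limit set of an ultrafilter is the limit set of a primitive net, so the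
    points of [fellH G] are exactly the nonempty sets [limits F] with [F] an
    ultrafilter on [G]. Everything below is read off from such representations.

    The space. A quasi-compact set of an ultrafilter [F] meets [limits F], and an
    open set that meets [limits F] belongs to [F]. If [U] is an ultrafilter on
    [fellH X] and every [A] is written [limits (F A)], the sum of the ultrafilters
    [F A] along [U] is an ultrafilter on [X] whose limit set is the limit of [U],
    provided that some quasi-compact [Q] meets [U]-almost all [A] (this keeps the
    limit set nonempty). Hence the sets of those [A] that meet a given [Q] are
    quasi-compact ([ultra_hit]). Closed sets are told apart by the quasi-compact
    neighbourhoods of points outside them, whence the Hausdorff property. The
    closure of [Y] in [fellH X] consists of the nonempty limit sets of the
    ultrafilters that contain [Y] ([closure_fellH_point]).

    The algebra. Let [A = limits F] and [a] in [A]. The unit space being Hausdorff,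
    range and source are constant on [A]. From the identities [x = x s(x)] and
    [s(x) = x^-1 x] and the continuity of the operations, [A^-1 A] is the limit set
    of the image of [F] under [s] ([limits_src]); in particular it is a point of the
    closure of the unit space, and [A A^-1 A = A] ([fell_mulVK]). As the product of
    subsets of a groupoid is associative and inversion reverses it, the groupoid
    axioms follow formally from this identity and from [U U^-1 = U] for [U] in the
    closure of the unit space ([fell_unit_rng]).

    The product. Let [A^-1 A = B B^-1], [A = limits F] and [b] in [B]. The range map
    being open, [F] lifts to an ultrafilter [P] on composable pairs whose second
    component converges to [b]. The limit set of that second component is a set
    [B'] containing [b] with [B' B'^-1 = B B^-1], and such a set is determined by
    [b], so [B' = B]. Pushing [P] forward by the multiplication then gives an
    ultrafilter with limit set [AB] ([fell_mul_ex]).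

    Continuity. That [AB] meets an open set is an open condition on [(A, B)] because
    the multiplication of [G] is continuous. If products [A'B'] meet a fixed
    quasi-compact [Q] for [(A', B')] arbitrarily close to [(A, B)], choose points of
    [A'B'] in [Q] that converge to some [q]; dividing by a point [a] of [A] shows
    that [a^-1 q] lies in [B], so [AB] meets [Q] ([fell_mul_continuous]). *)

(** * Ultrafilters *)

Lemma ultra_setC (T : Type) (F : set_system T) (A : set T) :
  UltraFilter F -> F (~` A) = (~ F A).
Proof.
move=> FU; rewrite propeqE; split=> [FnA FA|nFA].
  by have [x []] := filter_ex (filterI FnA FA).
by have [] := in_ultra_setVsetC A FU.
Qed.

Lemma ultra_decide (T : Type) (F : set_system T) :
  ProperFilter F -> (forall A, F A \/ F (~` A)) -> UltraFilter F.
Proof.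
move=> FF Fdec; split=> // H HF FH; apply/seteqP; split=> // A HA.
have [//|/FH HnA] := Fdec A.
by have [x []] := filter_ex (filterI HA HnA).
Qed.

Lemma fmap_ultra (T U : Type) (f : T -> U) (F : set_system T) :
  UltraFilter F -> UltraFilter (f x @[x --> F]).
Proof.
move=> FU; apply: ultra_decide => A.
exact: in_ultra_setVsetC (f @^-1` A) FU.
Qed.

(** The sum of the ultrafilters [F i] along [U]: membership is decided by asking,
    for [U]-almost all [i], the ultrafilter [F i]. *)
Lemma ultra_sum (I T : Type) (U : set_system I) (F : I -> set_system T) :
  UltraFilter U -> (forall i, UltraFilter (F i)) ->
  UltraFilter [set S | U [set i | F i S]].
Proof.
move=> UU FU; apply: ultra_decide => [|A] /=.
  apply: Build_ProperFilter_ex; first by move=> A /= /filter_ex[i]; exact: filter_ex.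
  split=> [|A B /= UA UB|A B AB /= UA].
  - by rewrite /=; apply: filterS filterT => i _; apply: filterT.
  - by apply: filterS (filterI UA UB) => i [FA FB]; apply: filterI.
  - by apply: filterS UA => i; apply: filterS.
have [|UnA] := in_ultra_setVsetC [set i | F i A] UU; first by left.
by right; apply: filterS UnA => i /=; rewrite ultra_setC.
Qed.

Lemma ultra_subsetE (T : Type) (F H : set_system T) :
  UltraFilter F -> ProperFilter H -> F `<=` H -> H = F.
Proof. by move=> FU HF /(max_filter HF). Qed.

(** Turns the failure of a convergence into an ultrafilter witnessing it. *)
Lemma ultra_refine (T : Type) (F : set_system T) (S : set T) : Filter F ->
  ~ F S -> exists H, [/\ UltraFilter H, F `<=` H & H (~` S)].
Proof.
move=> FF nFS; have WF : ProperFilter (within (~` S) F).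
  apply: Build_ProperFilter_ex => A; rewrite /within /= => WA.
  apply: contrapT => nA; apply: nFS; apply: filterS WA => x Ax.
  by apply: contrapT => /Ax {}Ax; apply: nA; exists x.
have [H [HU WH]] := ultraFilterLemma WF; exists H; split=> //.
  by move=> A FA; apply: WH; apply: filterS FA => x.
by apply: WH; exact: withinT.
Qed.

(** The condition says that every set of [F] meets every [f @^-1` E] with [E] in
    [D], so that [F] and these preimages generate a proper filter. *)
Lemma ultra_lift (T U : Type) (f : T -> U) (D : set_system U)
    (F : set_system T) :
  UltraFilter D -> Filter F -> (forall S, F S -> D (f @` S)) ->
  exists H, [/\ UltraFilter H, F `<=` H & f x @[x --> H] = D].
Proof.
move=> DU FF FD.
pose B := [set p : set T * set U | F p.1 /\ D p.2].
pose K := filter_from B (fun p => p.1 `&` f @^-1` p.2).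
have KF : ProperFilter K.
  apply: filter_from_proper => [|[S E] [/= FS DE]].
    apply: filter_from_filter => [|[S E] [S' E'] [/= FS DE] [FS' DE']].
      by exists (setT, setT); split; apply: filterT.
    exists (S `&` S', E `&` E'); first by split; apply: filterI.
    by move=> x /= [[Sx S'x] [Ex E'x]].
  have [_ [[x Sx <-] Ex]] := filter_ex (filterI (FD S FS) DE).
  by exists x.
have [H [HU KH]] := ultraFilterLemma KF; exists H; split=> // [S FS|].
  apply: KH; exists (S, setT); first by split=> //; apply: filterT.
  by move=> x [].
apply: ultra_subsetE => E DE; apply: KH; exists (setT, E).
  by split=> //; apply: filterT.
by move=> x [].
Qed.

(** * Quasi-compactness by ultrafilters *)

Section Compactness.
Context {X : topologicalType}.
Implicit Types (F : set_system X) (Q U V : set X).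

(** For the converse, if no finite subfamily covers [Q], the complements in [Q] of
    its finite unions generate a proper filter; an ultrafilter above it has a
    limit in [Q], which lies in a member of the cover: a contradiction. *)
Lemma cover_compactP Q : cover_compact Q <->
  forall F, UltraFilter F -> F Q -> exists2 q, Q q & F --> q.
Proof.
split=> [Qco F FU FQ|Qu I D f fop Qf].
  apply: contrapT => nolim.
  have [|q Qq|D' D'D QD'] := Qco _ [set V : set X | open V /\ ~ F V] id.
  - by move=> V [].
  - apply: contrapT => nq; apply: nolim; exists q => // U.
    rewrite nbhsE => -[V [oV Vq] VU]; apply: contrapT => nFU.
    apply: nq; exists V => //=; split=> // FV; apply: nFU.
    exact: filterS VU FV.
  - have : F (\bigcap_(V in [set` D']) ~` V).
      by apply: filter_bigI => V /D'D; rewrite inE ultra_setC => -[].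
    by move=> /(filterI FQ) /filter_ex[x [/QD'[V D'V Vx] /(_ V D'V)]].
apply: contrapT => nofin.
pose B := [set D' : {fset I} | {subset D' <= D}].
pose K := filter_from B (fun D' => Q `\` cover [set` D'] f).
have KF : ProperFilter K.
  apply: filter_from_proper => [|D' D'D].
    apply: filter_from_filter => [|D1 D2 D1D D2D]; first by exists fset0.
    exists (D1 `|` D2)%fset => [i /fsetUP[/D1D|/D2D]//|].
    by move=> x [Qx nx]; split; split=> // -[i Di fix_]; apply: nx; exists i => //=;
      rewrite inE (Di : is_true (_ \in _)) ?orbT.
  apply: contrapT => nx; apply: nofin; exists D' => // x Qx.
  by apply: contrapT => xD'; apply: nx; exists x.
have [F [FU KF']] := ultraFilterLemma KF.
have [|q Qq Fq] := Qu F FU; first by apply: KF'; exists fset0 => // x [].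
have [i Di fiq] := Qf q Qq.
have Ffi : F (f i) by apply: Fq; apply: open_nbhs_nbhs; split=> //; exact: fop.
have Fn : F (Q `\` cover [set` [fset i]%fset] f).
  by apply: KF'; exists [fset i]%fset => // j /fset1P ->; rewrite inE.
have [x [fix_ [_]]] := filter_ex (filterI Ffi Fn).
by apply; exists i => //=; rewrite inE.
Qed.

(** Compact Hausdorff spaces are regular: inside a compact Hausdorff neighbourhood
    [K] of [x], the relatively closed neighbourhoods of [x] form a base, and they
    are quasi-compact. They need not be closed in [X]. *)
Lemma cover_compact_nbhs_base (x : X) U : locally_compact_space X ->
  nbhs x U -> exists Q, [/\ cover_compact Q, nbhs x Q & Q `<=` U].
Proof.
move=> lcX nU; have [K nK [/cover_compactP Kco Khaus]] := lcX x.
pose x' : set_type K := SigSub (mem_set (nbhs_singleton nK)).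
have cvg_val (F : set_system (set_type K)) (k : set_type K) :
    Filter F -> set_val y @[y --> F] --> set_val k -> F --> k.
  move=> FF Fk S [_ [[V oV <-] /= Vk] VS]; apply: filterS VS _.
  exact: (Fk V (open_nbhs_nbhs (conj oV Vk))).
have val_continuous : continuous (set_val : set_type K -> X).
  exact: initial_continuous.
have KTco : compact [set: set_type K].
  rewrite compact_ultra => F FU _.
  have FU' := fmap_ultra set_val FU.
  have [|k Kk Fk] := Kco _ FU'.
    by apply: (@filterS _ F _ setT) filterT => y _; apply: set_valP.
  exists (SigSub (mem_set Kk)); split=> //; exact: cvg_val.
have nU' : nbhs x' (set_val @^-1` U) by apply: val_continuous.
have nT : nbhs x' [set: set_type K] by exact: filterT.
have [W nW WU] := compact_regular Khaus KTco nT nU'.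
exists (set_val @` closure W); split; last by move=> _ [y Wy <-]; apply: WU.
  apply/cover_compactP => F FU FQ.
  have [|k Kk Fk] := Kco F FU.
    by apply: filterS FQ => _ [y _ <-]; apply: set_valP.
  exists k => //; pose k' : set_type K := SigSub (mem_set Kk).
  exists k' => //; apply: (@closed_closure _ W).
  move=> S [_ [[V oV <-] /= Vk] VS].
  have FV : F V by apply: Fk; apply: open_nbhs_nbhs.
  have [_ [[y Wy <-] Vy]] := filter_ex (filterI FQ FV).
  by exists y; split=> //; apply: VS.
have [_ [[V oV <-] /= Vx] VW] := nW.
have nV : nbhs x V by apply: open_nbhs_nbhs.
apply: filterS (filterI nK nV) => y [Ky Vy].
by exists (SigSub (mem_set Ky)) => //; apply: subset_closure; apply: VW.
Qed.

End Compactness.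

(** * The space of nonempty limit sets *)

Definition limits (X : topologicalType) (F : set_system X) : set X :=
  [set p | F --> p].

Section FellSpace.
Context {X : topologicalType}.
Implicit Types (F : set_system X) (A B : fellH X) (p : X) (Q V : set X).

(** An ultrafilter above the tails of a net converges at least to the limits of
    the net and at most to its cluster points; primitivity makes the two agree. *)
Lemma net_lim_limits (x : net X) : primitive_net x ->
  exists2 F, UltraFilter F & net_lim x = limits F.
Proof.
move=> xprim.
pose K : set_system X := [set S | exists i, forall j, net_le i j -> S (x j)].
have KF : ProperFilter K.
  apply: Build_ProperFilter_ex => [S [i /(_ i) Si]|].
    by exists (x i); apply: Si; apply: net_le_refl.
  split=> [|S T [i Si] [j Tj]|S T ST [i Si]].
  - by have [i] := net_inhabited x; exists i.
  - have [k [ik jk]] := net_directed i j; exists k => l kl; split.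
      by apply: Si; apply: net_le_trans kl.
    by apply: Tj; apply: net_le_trans kl.
  - by exists i => j /Si /ST.
have [F [FU KF']] := ultraFilterLemma KF; exists F => //.
apply/seteqP; split=> [p px U nU|p Fp]; first by apply: KF'; exact: px.
apply: xprim => U nU i; apply: contrapT => nUj.
suff /(filterI (Fp U nU)) /filter_ex[y [Uy]] : F (~` U) by [].
by apply: KF'; exists i => j ij Uj; apply: nUj; exists j.
Qed.

(** The net is indexed by the pointed sets [(y, S)] with [S] in [F], ordered by
    reverse inclusion of [S]. It is primitive because a set outside [F] has its
    complement in [F]. *)
Lemma limits_net_lim F : UltraFilter F ->
  exists2 x : net X, primitive_net x & limits F = net_lim x.
Proof.
move=> FU; pose I := {q : X * set X | F q.2 /\ q.2 q.1}.
pose le (i j : I) := (sval j).2 `<=` (sval i).2.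
have I0 : inhabited I.
  have [y _] := filter_ex (@filterT _ F _).
  by split; exists (y, setT); split=> //; apply: filterT.
have leI : forall i j, exists k, le i k /\ le j k.
  move=> [[y S] [/= FS Sy]] [[z T] [/= FT Tz]].
  have FST : F (S `&` T) by exact: filterI.
  have [w STw] := filter_ex FST.
  by exists (exist _ (w, S `&` T) (conj FST STw)); split=> v [].
pose x : net X := @Net X I le I0 (fun _ _ => id)
  (fun i j k ij jk v kv => ij v (jk v kv)) leI (fun i => (sval i).1).
have xF p : net_lim x p <-> F --> p.
  split=> [px U nU|Fp U nU].
    have [[[y S] [/= FS Sy]] US] := px U nU; apply: filterS (FS) => z Sz.
    exact: (US (exist _ (z, S) (conj FS Sz))).
  have FUn := Fp U nU; have [y Uy] := filter_ex FUn.
  exists (exist _ (y, U) (conj FUn Uy)) => -[[z S] [/= FS Sz]] SU.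
  exact: SU.
exists x; last by apply/seteqP; split=> p /xF.
move=> p px; apply/xF => U nU; apply: contrapT.
rewrite -ultra_setC => FnU; have [y nUy] := filter_ex FnU.
have [[[z S] [/= FS Sz]] SnU Uz] := px U nU (exist _ (y, _) (conj FnU nUy)).
exact: SnU Uz.
Qed.

Lemma fellH_limits A : exists2 F, UltraFilter F & fellH_set A = limits F.
Proof.
rewrite /fellH_set; have [x /net_lim_limits[F FU xF] ->] := fell_setP (set_val A).
by exists F.
Qed.

Lemma limits_fellH F : UltraFilter F -> limits F !=set0 ->
  exists A, fellH_set A = limits F.
Proof.
move=> /limits_net_lim /[dup] FP [x xprim Fx] F0.
have F0' : [set A : fellK X | A !=set0] (FellK FP) by [].
by exists (SigSub (mem_set F0')); rewrite /fellH_set set_valE.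
Qed.

Lemma fellH_neq0 A : fellH_set A !=set0.
Proof. by have := set_valP A. Qed.

Lemma fell_set_inj : injective (@fell_set X).
Proof.
move=> [a aP] [b bP] /= ab; subst b.
by rewrite (Prop_irrelevance aP bP).
Qed.

Lemma fellH_set_inj : injective (@fellH_set X).
Proof. by move=> A B /fell_set_inj; exact: val_inj. Qed.

Definition hit V : set (fellH X) := [set A | fellH_set A `&` V !=set0].
Definition miss Q : set (fellH X) := [set A | fellH_set A `&` Q = set0].

Lemma missE Q : miss Q = ~` hit Q.
Proof.
by apply/seteqP; split=> A /nonemptyPn.
Qed.

Lemma fell_subbase_open (W : set (fellK X)) : fell_subbase W -> open W.
Proof.
move=> WS; exists [set W]; last by rewrite bigcup_set1.
move=> _ ->. exact: finI_from1.
Qed.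

Lemma hit_open V : open V -> open (hit V).
Proof.
by move=> oV; exists [set A : fellK X | A `&` V !=set0] => //;
  apply: fell_subbase_open; left; exists V.
Qed.

Lemma miss_open Q : cover_compact Q -> open (miss Q).
Proof.
by move=> Qco; exists [set A : fellK X | A `&` Q = set0] => //;
  apply: fell_subbase_open; right; exists Q.
Qed.

Lemma fellH_cvgP (Phi : set_system (fellH X)) A : Filter Phi ->
  (forall V, open V -> hit V A -> Phi (hit V)) ->
  (forall Q, cover_compact Q -> miss Q A -> Phi (miss Q)) ->
  Phi --> A.
Proof.
move=> PF PV PQ W; rewrite nbhsE => -[_ [[O [D' D'fin <-] <-] /=]].
move=> [S D'S SA] OW; have [E Esub SE] := D'fin S D'S.
suff PS : Phi (set_val @^-1` S) by apply: filterS PS => B SB; apply: OW; exists S.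
rewrite -SE preimage_bigcap; apply: filter_bigI => T ET.
have TA : T (set_val A) by move: SA; rewrite -SE; apply.
by have /Esub := ET; rewrite inE => -[[V oV TE]|[Q Qco TE]];
  rewrite TE; [apply: PV|apply: PQ] => //; rewrite TE in TA.
Qed.

Hypothesis lcX : locally_compact_space X.

(** If [A = limits F] and [F] does not converge to [p], some open neighbourhood of
    [p] is not in [F], and no limit of [F] lies in it. *)
Lemma fellH_separate A p : ~ fellH_set A p ->
  exists Q, [/\ cover_compact Q, nbhs p Q & miss Q A].
Proof.
have [F FU AF] := fellH_limits A; rewrite {1}AF => /existsNP[U /not_implyP[nU nFU]].
have [V [oV Vp] VU] : exists2 V, open_nbhs p V & V `<=` U by move: nU; rewrite nbhsE.
have [Q [Qco nQ QV]] := cover_compact_nbhs_base lcX (open_nbhs_nbhs (conj oV Vp)).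
exists Q; split=> //; apply/nonemptyPn => -[q []]; rewrite AF => Fq /QV Vq.
by apply: nFU; apply: filterS VU _; apply: Fq; apply: open_nbhs_nbhs.
Qed.

Lemma fellH_hausdorff : hausdorff_space (fellH X).
Proof.
have sub A B : cluster (nbhs A) B -> fellH_set A `<=` fellH_set B.
  move=> AB p Ap; apply: contrapT => /fellH_separate[Q [Qco nQ QB]].
  have nhit : nbhs A (hit Q^°).
    apply: open_nbhs_nbhs; split; first exact/hit_open/open_interior.
    by exists p.
  have nmiss : nbhs B (miss Q).
    by apply: open_nbhs_nbhs; split=> //; exact: miss_open.
  have [C [[q [Cq /interior_subset Qq]] /nonemptyPn[]]] := AB _ _ nhit nmiss.
  by exists q.
move=> A B AB; apply: fellH_set_inj; apply/seteqP; split; apply: sub => //.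
by move=> U V nU nV; rewrite setIC; exact: AB.
Qed.

(** The limit is the limit set of the sum [S] along [U] of ultrafilters that
    represent the points of [fellH X]. The hypothesis on [Q] excludes the limit
    being the empty set, which is the missing point at infinity. *)
Lemma ultra_hit (U : set_system (fellH X)) Q : UltraFilter U ->
  cover_compact Q -> U (hit Q) ->
  exists A, [/\ U --> A & hit Q A].
Proof.
move=> UU Qco UQ.
have /choice[F FP] A : exists F, UltraFilter F /\ fellH_set A = limits F.
  by have [F] := fellH_limits A; exists F.
have FU A := (FP A).1; have AF A := (FP A).2.
pose S := [set S | U [set A | F A S]].
have SU : UltraFilter S by exact: ultra_sum.
have hitS V : open V -> U (hit V) -> S V.
  move=> oV; apply: filterS => A [p []]; rewrite AF => Fp Vp.
  by apply: Fp; apply: open_nbhs_nbhs.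
have Sp p : limits S p <-> forall V, open V -> V p -> U (hit V).
  split=> [Sp V oV Vp|Up W].
    have nV : nbhs p V by exact: open_nbhs_nbhs.
    have [K [Kco nK KV]] := cover_compact_nbhs_base lcX nV.
    have : U [set A | F A K] by exact: Sp.
    apply: filterS => A /= FK; have /cover_compactP /(_ (F A) _ FK)[q Kq Fq] := Kco.
    by exists q; split; [rewrite AF|exact: KV].
  rewrite nbhsE => -[V [oV Vp] VW]; apply: filterS VW _.
  by apply: hitS => //; exact: Up.
have hitlim K : cover_compact K -> U (hit K) -> (limits S `&` K) !=set0.
  move=> Kco UK; apply: contrapT => nSK.
  have [|q Kq|D' D'D KD'] := Kco _ [set V : set X | open V /\ ~ U (hit V)] id.
  - by move=> V [].
  - apply: contrapT => nq; apply: nSK; exists q; split=> //.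
    apply/Sp => V oV Vq; apply: contrapT => nUV; apply: nq; exists V => //.
  - have : U (\bigcap_(V in [set` D']) ~` hit V).
      by apply: filter_bigI => V /D'D; rewrite inE ultra_setC => -[].
    move=> /(filterI UK) /filter_ex[A [[q [Aq /KD'[V D'V Vq]]] /(_ V D'V)]].
    by apply; exists q.
have [q [Sq Qq]] := hitlim Q Qco UQ.
have [A AS] := limits_fellH SU (ex_intro _ q Sq).
exists A; split; last by exists q; rewrite AS.
apply: fellH_cvgP => [V oV [p []]|K Kco].
  by rewrite AS => /Sp Up Vp; exact: Up.
by rewrite missE ultra_setC /hit /= AS => nSK /hitlim; apply: contra_not nSK; apply.
Qed.

Lemma fellH_locally_compact : locally_compact_space (fellH X).
Proof.
move=> A; have [a Aa] := fellH_neq0 A.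
have [Q [Qco nQ _]] := cover_compact_nbhs_base lcX (@filterT _ (nbhs a) _).
exists (hit Q).
  have : nbhs A (hit Q^°).
    apply: open_nbhs_nbhs; split; first exact/hit_open/open_interior.
    by exists a.
  by apply: filterS => B [q [Bq /interior_subset Qq]]; exists q.
split.
  apply/cover_compactP => U UU UQ.
  by have [B [UB QB]] := ultra_hit UU Qco UQ; exists B.
move=> B C BC; apply: val_inj; apply: fellH_hausdorff => V W nV nW.
have [D [VD WD]] := BC _ _ (initial_continuous nV) (initial_continuous nW).
by exists (set_val D).
Qed.

(** If an ultrafilter [F] on [X] contains [Y], the points of [Y] converge along
    [F] to [limits F]; conversely an ultrafilter above the traces on [Y] of the
    neighbourhoods of [A] has limit set [A]. *)
Lemma closure_fellH_point (Y : set X) A :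
  closure (fellH_point lcX @` Y) A <->
  exists F, [/\ UltraFilter F, F Y & fellH_set A = limits F].
Proof.
have hit_point V (x : X) : hit V (fellH_point lcX x) <-> V x.
  by split=> [[q [<-]]|Vx]; last exists x.
split=> [clA|[F [FU FY AF]] W nW].
  pose K := filter_from (nbhs A) (fun W => Y `&` fellH_point lcX @^-1` W).
  have KF : ProperFilter K.
    apply: filter_from_proper => [|W nW].
      apply: filter_from_filter => [|V W nV nW]; first by exists setT; exact: filterT.
      by exists (V `&` W) => [|x [Yx []]]; first exact: filterI.
    by have [_ [[x Yx <-] Wx]] := clA W nW; exists x.
  have [F [FU KF']] := ultraFilterLemma KF; exists F; split=> //.
    by apply: KF'; exists setT; [exact: filterT|move=> x []].
  apply/seteqP; split=> p.
    move=> Ap W; rewrite nbhsE => -[V [oV Vp] VW]; apply: filterS VW _.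
    apply: KF'; exists (hit V); last by move=> x [_ /hit_point].
    apply: open_nbhs_nbhs; split; first exact: hit_open.
    by exists p.
  move=> Fp; apply: contrapT => /fellH_separate[Q [Qco nQ QA]].
  have : F (~` Q).
    apply: KF'; exists (miss Q); last by rewrite missE => x [_ nx] /hit_point.
    by apply: open_nbhs_nbhs; split=> //; exact: miss_open.
  by rewrite ultra_setC; apply; exact: Fp.
have FA : fellH_point lcX x @[x --> F] --> A.
  apply: fellH_cvgP => [V oV [p []]|Q Qco QA].
    rewrite AF => Fp Vp; have FV : F V by apply: Fp; exact: open_nbhs_nbhs.
    by apply: (@filterS _ F _ V) FV => x Vx; apply/hit_point.
  have : F (~` Q).
    rewrite ultra_setC; move: QA; rewrite missE => + FQ; apply.
    have /cover_compactP /(_ F FU FQ)[q Qq Fq] := Qco.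
    by exists q; rewrite AF.
  by apply: (@filterS _ F) => x nQx; rewrite /= missE => /hit_point.
have FW : F (fellH_point lcX @^-1` W) by exact: FA.
by have [x [Yx Wx]] := filter_ex (filterI FY FW); exists (fellH_point lcX x); split.
Qed.

End FellSpace.

(** * Products of subsets of a groupoid *)

Section GroupoidAlgebra.
Context {G : Type} (g : groupoid G).
Implicit Types (x y z : G) (A B C : set G).

Local Notation r := (grng g).
Local Notation s := (gsrc g).
Local Notation m := (gmul g).
Local Notation i := (ginv g).

Lemma gmulKl x y : s x = r y -> m (i x) (m x y) = y.
Proof.
move=> xy; rewrite gmulA ?gsrc_inv //.
by rewrite gmul_invl xy gmul_rngl.
Qed.

Lemma gmulVKl x y : r x = r y -> m x (m (i x) y) = y.
Proof.
move=> xy; rewrite gmulA ?gsrc_inv ?grng_inv //.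
by rewrite gmul_invr xy gmul_rngl.
Qed.

Lemma gmulKr x y : s x = r y -> m (m x y) (i y) = x.
Proof.
move=> xy; rewrite -gmulA ?grng_inv //.
by rewrite gmul_invr -xy gmul_srcr.
Qed.

Lemma ginvK : involutive i.
Proof.
move=> x; have := @gmulKl (i x) x (gsrc_inv g x).
have sii : s (i (i x)) = s x by rewrite gsrc_inv grng_inv.
by rewrite gmul_invl -sii gmul_srcr.
Qed.

Lemma ginvM x y : s x = r y -> i (m x y) = m (i y) (i x).
Proof.
move=> xy; have sxy : s (m x y) = s y by exact: gsrc_mul.
have ryx : s (i y) = r (i x) by rewrite gsrc_inv grng_inv.
have xyV : m (m x y) (m (i y) (i x)) = set_val (s (i (m x y))).
  rewrite gmulA ?sxy ?grng_inv ?gsrc_inv ?xy // gmulKr // [m _ _]gmul_invr.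
  by rewrite grng_mul.
rewrite -[RHS](@gmulKl (m x y) (m (i y) (i x))) ?xyV; first by rewrite gmul_srcr.
by rewrite sxy grng_mul // grng_inv.
Qed.

Lemma set_invK A : set_inv g (set_inv g A) = A.
Proof.
apply/seteqP; split=> [_ [_ [x Ax <-] <-]|x Ax]; first by rewrite [X in A X]ginvK.
by exists (i x); [exists x|exact: ginvK].
Qed.

Lemma set_mulA A B C : set_mul g A (set_mul g B C) = set_mul g (set_mul g A B) C.
Proof.
apply/seteqP; split=> [_ [x [_ [Ax [y [z [By Cz yz ->]]] xyz ->]]]|
                      _ [_ [z [[x [y [Ax By xy ->]]] Cz xyz ->]]]].
- rewrite grng_mul // in xyz; exists (m x y), z; split=> //.
  + by exists x, y.
  + by rewrite gsrc_mul.
  + by rewrite gmulA.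
- rewrite gsrc_mul // in xyz; exists x, (m y z); split=> //.
  + by exists y, z.
  + by rewrite grng_mul.
  + by rewrite gmulA.
Qed.

Lemma set_invM A B :
  set_inv g (set_mul g A B) = set_mul g (set_inv g B) (set_inv g A).
Proof.
apply/seteqP; split=> [_ [_ [x [y [Ax By xy ->]]] <-]|
                      _ [_ [_ [[y By <-] [x Ax <-] yx ->]]]].
- exists (i y), (i x); split; [by exists y|by exists x| |exact: ginvM].
  by rewrite gsrc_inv grng_inv.
- rewrite gsrc_inv grng_inv in yx; exists (m x y); last exact: ginvM.
  by exists x, y.
Qed.

End GroupoidAlgebra.

(** * Limit sets of ultrafilters on a groupoid *)

Section LimitSets.
Context {G : topologicalType} (g : groupoid G).
Hypotheses (topG : topological_groupoid g)
  (hausG0 : hausdorff_space (set_type (gunits g))).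

Local Notation r := (grng g).
Local Notation s := (gsrc g).
Local Notation m := (gmul g).
Local Notation i := (ginv g).

(** Continuity of the multiplication within the composable pairs, without
    reference to the topology of the product. *)
Lemma gmul_nbhs x y (W : set G) : s x = r y -> nbhs (m x y) W ->
  exists V1 V2, [/\ nbhs x V1, nbhs y V2 &
    forall x' y', V1 x' -> V2 y' -> s x' = r y' -> W (m x' y')].
Proof.
move=> xy nW; have [/subspace_continuousP mcont _] := topG.
have [[V1 V2] /= [nV1 nV2] VW] := mcont (x, y) xy W nW.
exists V1, V2; split=> // x' y' Vx' Vy' xy'.
exact: (VW (x', y')).
Qed.

Lemma gmul_cvg I (F : set_system I) (f h : I -> G) x y : Filter F ->
  (F [set j | s (f j) = r (h j)]) -> s x = r y ->
  f j @[j --> F] --> x -> h j @[j --> F] --> y ->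
  m (f j) (h j) @[j --> F] --> m x y.
Proof.
move=> FF Fcomp xy fx hy W nW.
have [V1 [V2 [nV1 nV2 VW]]] := gmul_nbhs xy nW.
have FV1 : F (f @^-1` V1) := fx _ nV1.
have FV2 : F (h @^-1` V2) := hy _ nV2.
apply: (@filterS _ F) (filterI Fcomp (filterI FV1 FV2)) => j [fh [V1f V2h]].
exact: (VW _ _ V1f V2h fh).
Qed.

Lemma ginv_cvg I (F : set_system I) (f : I -> G) x : Filter F ->
  f j @[j --> F] --> x -> i (f j) @[j --> F] --> i x.
Proof. by move=> FF fx; apply: cvg_comp fx _; exact: topG.2. Qed.

Lemma gsrc_cvg I (F : set_system I) (f : I -> G) x : Filter F ->
  f j @[j --> F] --> x -> s (f j) @[j --> F] --> s x.
Proof.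
move=> FF fx W; rewrite nbhsE => -[_ [[V oV <-] /= Vx] VW].
have VF : F [set j | V (m (i (f j)) (f j))].
  apply: (@gmul_cvg _ F (i \o f) f (i x) x) => //.
  - by apply: filterS filterT => j _ /=; rewrite gsrc_inv.
  - by rewrite gsrc_inv.
  - exact: ginv_cvg.
  - by rewrite gmul_invl; apply: open_nbhs_nbhs.
by apply: (@filterS _ F) VF => j; rewrite /= gmul_invl => Vj; apply: VW.
Qed.

Lemma grng_cvg I (F : set_system I) (f : I -> G) x : Filter F ->
  f j @[j --> F] --> x -> r (f j) @[j --> F] --> r x.
Proof.
move=> FF fx; rewrite -gsrc_inv.
have -> : (fun j => r (f j)) = s \o (i \o f).
  by apply/funext => j /=; rewrite gsrc_inv.
by apply: gsrc_cvg; exact: ginv_cvg.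
Qed.

Lemma unit_cvg_unique (F : set_system (set_type (gunits g)))
    (u v : set_type (gunits g)) :
  ProperFilter F -> F --> u -> F --> v -> u = v.
Proof.
move=> FF Fu Fv; apply: hausG0 => V W nV nW.
by have [w ?] := filter_ex (filterI (Fu V nV) (Fv W nW)); exists w.
Qed.

Lemma limits_gsrc (F : set_system G) x y : UltraFilter F ->
  limits F x -> limits F y -> s x = s y.
Proof.
move=> FU Fx Fy.
by apply: (@unit_cvg_unique (s z @[z --> F])); exact: gsrc_cvg.
Qed.

Lemma limits_grng (F : set_system G) x y : UltraFilter F ->
  limits F x -> limits F y -> r x = r y.
Proof.
move=> FU Fx Fy.
by apply: (@unit_cvg_unique (r z @[z --> F])); exact: grng_cvg.
Qed.

Definition src_ultra (F : set_system G) : set_system G :=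
  set_val (s x) @[x --> F].

Definition rng_ultra (F : set_system G) : set_system G :=
  set_val (r x) @[x --> F].

Lemma limits_inv (F : set_system G) : UltraFilter F ->
  set_inv g (limits F) = limits (i x @[x --> F]).
Proof.
move=> FU; apply/seteqP; split=> [_ [x Fx <-]|x Fx].
  exact: (@ginv_cvg _ F id).
exists (i x); last exact: ginvK.
have : (i \o i) y @[y --> F] --> i x := ginv_cvg _ Fx.
have -> : i \o i = id by apply/funext => y; exact: ginvK.
by move=> ix; exact: ix.
Qed.

(** This is the identity [x = x s(x)] passed to the limit along [F]. *)
Lemma limits_mul_src (F : set_system G) x c : UltraFilter F ->
  limits F x -> limits (src_ultra F) c -> s x = r c /\ limits F (m x c).
Proof.
move=> FU Fx Fc; have xc : s x = r c.
  apply: (@unit_cvg_unique (s z @[z --> F])); first exact: gsrc_cvg.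
  have : (fun y => r (set_val (s y))) y @[y --> F] --> r c := grng_cvg _ Fc.
  have -> : (fun y => r (set_val (s y))) = s.
    by apply/funext => y; rewrite grng_unit.
  by move=> sc; exact: sc.
split=> //; have -> : F = m y (set_val (s y)) @[y --> F].
  have -> : (fun y => m y (set_val (s y))) = id by apply/funext => y; exact: gmul_srcr.
  by [].
apply: gmul_cvg => //.
by apply: (@filterS _ F) filterT => y _; rewrite /= grng_unit.
Qed.

(** One inclusion is the identity [s(x) = x^-1 x] passed to the limit; for the
    other, [c = a^-1 (a c)] where [a c] is a limit of [F] by [limits_mul_src]. *)
Lemma limits_src (F : set_system G) : UltraFilter F -> limits F !=set0 ->
  set_mul g (set_inv g (limits F)) (limits F) = limits (src_ultra F).
Proof.
move=> FU [a Fa]; apply/seteqP; split=> [_ [_ [y [[x Fx <-] Fy xy ->]]]|c Fc].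
  have srcE : (fun z => m (i z) z) = (fun z => set_val (s z)).
    by apply/funext => z; exact: gmul_invl.
  rewrite /src_ultra -srcE.
  apply: (@gmul_cvg _ F i id) => //.
    by apply: (@filterS _ F) filterT => z _; rewrite /= gsrc_inv.
  exact: (@ginv_cvg _ F id).
have [ac Fac] := limits_mul_src FU Fa Fc.
exists (i a), (m a c); split=> //; first by exists a.
  by rewrite gsrc_inv grng_mul.
by rewrite gmulKl.
Qed.

Lemma limits_rng (F : set_system G) : UltraFilter F -> limits F !=set0 ->
  set_mul g (limits F) (set_inv g (limits F)) = limits (rng_ultra F).
Proof.
move=> FU [a Fa]; have FU' := fmap_ultra i FU.
have : limits (i x @[x --> F]) !=set0.
  by exists (i a); rewrite -limits_inv //; exists a.
move=> /limits_src; rewrite -limits_inv // set_invK => ->.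
congr limits; rewrite /src_ultra /rng_ultra.
have -> : (fun x => set_val (r x)) = (fun x => set_val (s (i x))).
  by apply/funext => x; rewrite gsrc_inv.
done.
Qed.

End LimitSets.

(** * Products of limit sets *)

Section FellGroupoid.
Context {G : topologicalType} (g : groupoid G).
Hypotheses (topG : topological_groupoid g)
  (lcG : locally_compact_space G)
  (hausG0 : hausdorff_space (set_type (gunits g)))
  (open_rng : open_map (grng g)).
Implicit Types A B C : fellH G.

Local Notation r := (grng g).
Local Notation s := (gsrc g).
Local Notation m := (gmul g).
Local Notation i := (ginv g).
Local Notation "[ A ]" := (fellH_set A).
Local Notation "S ** T" := (set_mul g S T) (at level 40).
Local Notation "S ^!" := (set_inv g S) (at level 3, format "S ^!").

(** [A] is a coset [a H] of the isotropy subgroup [H = A^-1 A]. The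
    groupoid axioms for [fellH G] that concern products rest on this identity. *)
Lemma fell_mulVK A : [A] ** ([A]^! ** [A]) = [A].
Proof.
have [F FU AF] := fellH_limits A.
have F0 : limits F !=set0 by rewrite -AF; exact: fellH_neq0.
apply/seteqP; split=> [_ [x [y [Ax Ay _ ->]]]|x Ax].
  rewrite {}AF limits_src // in Ax Ay *.
  exact: (limits_mul_src topG hausG0 FU Ax Ay).2.
exists x, (m (i x) x); split=> //; last by rewrite gmul_invl gmul_srcr.
  by exists (i x), x; split=> //; [exists x|rewrite gsrc_inv].
by rewrite gmul_invl grng_unit.
Qed.

Lemma fell_gsrc A x y : [A] x -> [A] y -> s x = s y.
Proof. by have [F FU ->] := fellH_limits A; exact: limits_gsrc. Qed.

Lemma fell_grng A x y : [A] x -> [A] y -> r x = r y.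
Proof. by have [F FU ->] := fellH_limits A; exact: limits_grng. Qed.

Lemma fell_inv_ex A : exists B, [B] = [A]^!.
Proof.
have [F FU AF] := fellH_limits A; have FU' := fmap_ultra i FU.
have [a Aa] := fellH_neq0 A.
have [|B BE] := limits_fellH FU'; last by exists B; rewrite AF limits_inv.
by exists (i a); rewrite -limits_inv // -AF; exists a.
Qed.

Lemma fell_rng_ex A : exists U : set_type (closure (fellH_point lcG @` gunits g)),
  [set_val U] = [A] ** [A]^!.
Proof.
have [F FU AF] := fellH_limits A.
have RU := fmap_ultra (fun x => set_val (r x)) FU.
have [a Aa] := fellH_neq0 A.
have rngE : [A] ** [A]^! = limits (rng_ultra g F).
  by rewrite AF limits_rng //; exists a; rewrite -AF.
have [|U UE] := limits_fellH RU.
  rewrite -[X in X !=set0]rngE; exists (m a (i a)), a, (i a); split=> //.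
    by exists a.
  by rewrite grng_inv.
have clU : closure (fellH_point lcG @` gunits g) U.
  apply/closure_fellH_point; exists (rng_ultra g F); split=> //.
  by apply: (@filterS _ F) filterT => x _; exact: set_valP.
by exists (SigSub (mem_set clU)); rewrite rngE.
Qed.

Lemma fell_src_ex A : exists U : set_type (closure (fellH_point lcG @` gunits g)),
  [set_val U] = [A]^! ** [A].
Proof.
have [B BA] := fell_inv_ex A; have [U UE] := fell_rng_ex B.
by exists U; rewrite UE BA set_invK.
Qed.

(** [U] is the limit set of an ultrafilter on the unit space, where the range map
    is the identity. *)
Lemma fell_unit_rng U : closure (fellH_point lcG @` gunits g) U ->
  [U] ** [U]^! = [U].
Proof.
move=> /closure_fellH_point[F [FU FG0 UF]].
rewrite UF limits_rng //; last by rewrite -UF; exact: fellH_neq0.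
suff FR : F `<=` rng_ultra g F.
  by rewrite (ultra_subsetE FU _ FR).
move=> S FS; apply: (@filterS _ F) (filterI FG0 FS) => x [G0x Sx].
pose u : set_type (gunits g) := SigSub (mem_set G0x).
have rx : set_val (r x) = x := congr1 set_val (grng_unit u).
by rewrite /= rx.
Qed.

Lemma fell_unit_inv U : closure (fellH_point lcG @` gunits g) U -> [U]^! = [U].
Proof.
move=> clU; rewrite -{1}(fell_unit_rng clU) set_invM set_invK.
exact: fell_unit_rng.
Qed.

(** Composability of the sets entails composability of all their elements: a
    product [y1 y2^-1] with [y1], [y2] in [B] has the range of [y1], and [x^-1 x] is
    such a product. *)
Lemma fell_comp A B x y : [A]^! ** [A] = [B] ** [B]^! ->
  [A] x -> [B] y -> s x = r y.
Proof.
move=> AB Ax By; have : ([B] ** [B]^!) (m (i x) x).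
  by rewrite -AB; exists (i x), x; split=> //; [exists x|rewrite gsrc_inv].
move=> [y1 [_ [By1 [y2 By2 <-] y12 xy]]].
rewrite (fell_grng By By1) -[RHS](grng_mul y12) -xy.
by rewrite grng_mul ?gsrc_inv ?grng_inv.
Qed.

(** The ultrafilter [P] on composable pairs comes from lifting [F] along the first
    projection; openness of the range map provides, close to any [b], elements [y]
    composable with [F]-almost all [x]. *)
Lemma fell_mul_ex A B : [A]^! ** [A] = [B] ** [B]^! ->
  exists C, [C] = [A] ** [B].
Proof.
move=> AB; have [a Aa] := fellH_neq0 A; have [b Bb] := fellH_neq0 B.
have [F FU AF] := fellH_limits A.
have comp x y : [A] x -> [B] y -> s x = r y by exact: fell_comp.
pose Phi := filter_from (nbhs b) (fun V => composable g `&` snd @^-1` V).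
have PhiF : Filter Phi.
  apply: filter_from_filter => [|V W nV nW]; first by exists setT; exact: filterT.
  by exists (V `&` W) => [|p [cp [Vp Wp]]]; first exact: filterI.
have [S PhiS|P [PU PhiP PF]] := ultra_lift FU PhiF (f := fst).
  have [V nV VS] := PhiS.
  have [O [oO Ob] OV] : exists2 O, open_nbhs b O & O `<=` V.
    by move: nV; rewrite nbhsE.
  have nrO : nbhs (s a) (r @` O).
    apply: open_nbhs_nbhs; split; first exact: open_rng.
    by exists b => //; rewrite (comp a b).
  have Fa : F --> a by rewrite AF in Aa.
  have : F (s @^-1` (r @` O)) by exact: (@gsrc_cvg _ _ topG _ F id a _ Fa).
  apply: filterS => x [y Oy ryx]; exists (x, y) => //.
  by apply: VS; split; [rewrite /composable /= ryx|exact: OV].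
have Pcomp : P (composable g).
  by apply: PhiP; exists setT; [exact: filterT|move=> p []].
have Pb : snd p @[p --> P] --> b.
  by move=> V nV; apply: PhiP; exists V => // p [].
(* The limit set of the second component [E] is [B]: both contain [b] and have
   the same range. *)
have EU := fmap_ultra snd PU; pose E := snd p @[p --> P].
have E0 : limits E !=set0 by exists b.
have rE : rng_ultra g E = src_ultra g F.
  rewrite -PF; apply/funext => S; apply/propext.
  suff : P [set p | S (set_val (r p.2))] <-> P [set p | S (set_val (s p.1))] by [].
  by split=> PS; apply: filterS (filterI Pcomp PS) => p [];
    rewrite /composable /= => ->.
have BE : limits E = [B].
  have [EH Ef] := limits_fellH EU E0.
  have Eb : [EH] b by rewrite Ef.
  have EB : [EH] ** [EH]^! = [B] ** [B]^!.
    by rewrite Ef limits_rng // rE -limits_src -?AF //; exact: fellH_neq0.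
  have sub A1 A2 : [A1] b -> [A2] b -> [A1] ** [A1]^! = [A2] ** [A2]^! ->
      [A1] `<=` [A2].
    move=> A1b A2b A12 y A1y; rewrite -(fell_mulVK A2) set_mulA -A12.
    have sby := fell_gsrc A1b A1y.
    have byV : s y = r (i b) by rewrite grng_inv -sby.
    exists (m y (i b)), b; split=> //.
    - by exists y, (i b); split=> //; exists b.
    - by rewrite gsrc_mul // gsrc_inv.
    - by rewrite -gmulA ?gsrc_inv // gmul_invl sby gmul_srcr.
  by rewrite -Ef; apply/seteqP; split; apply: sub.
have fstP x : [A] x -> fst p @[p --> P] --> x by rewrite PF AF.
have sndP y : [B] y -> snd p @[p --> P] --> y by rewrite -BE.
have KU := fmap_ultra (fun p : G * G => m p.1 p.2) PU.
have mulP x y : [A] x -> [B] y -> m p.1 p.2 @[p --> P] --> m x y.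
  move=> Ax By; apply: gmul_cvg => //; [exact: comp|exact: fstP|exact: sndP].
have [|C CE] := limits_fellH KU; first by exists (m a b); exact: mulP.
exists C; rewrite CE; apply/seteqP; split=> [c Pc|_ [x [y [Ax By _ ->]]]];
  last exact: mulP.
have rc : r a = r c.
  rewrite -(grng_mul (comp a b Aa Bb)).
  by apply: (@limits_grng _ _ topG hausG0 _ (m a b) c KU) => //; exact: mulP.
(* A limit [c] of the products is [a (a^-1 c)], and the identity
   [y = x^-1 (x y)] shows that [a^-1 c] is a limit of the second component. *)
have Bac : [B] (m (i a) c).
  rewrite -BE; have PE : E = m (i p.1) (m p.1 p.2) @[p --> P].
    apply/esym/ultra_subsetE => S PS.
    suff : P [set p | S (m (i p.1) (m p.1 p.2))] by [].
    apply: filterS (filterI Pcomp (PS : P [set p | S p.2])) => p [cp Sp].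
    by rewrite /= (gmulKl cp).
  rewrite PE; apply: gmul_cvg => //.
  - apply: (@filterS _ P) Pcomp => p cp /=.
    by rewrite gsrc_inv (grng_mul cp).
  - by rewrite gsrc_inv.
  - by apply: ginv_cvg => //; exact: fstP.
exists a, (m (i a) c); split=> //.
  by rewrite grng_mul ?gsrc_inv // grng_inv.
by rewrite gmulVKl.
Qed.


Lemma set_inv_compact Q : cover_compact Q -> cover_compact Q^!.
Proof.
move=> /cover_compactP Qco; apply/cover_compactP => F FU FQ.
have FU' := fmap_ultra i FU.
have [|q Qq Fq] := Qco _ FU'.
  by apply: (@filterS _ F) FQ => _ [q Qq <-] /=; rewrite ginvK.
exists (i q); first by exists q.
by move: Fq; rewrite -[_ --> q]/(limits _ q) -limits_inv // => -[x Fx <-];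
  rewrite ginvK.
Qed.

Lemma fell_inv_continuous (f : fellH G -> fellH G) :
  (forall A, [f A] = [A]^!) -> continuous f.
Proof.
move=> fE; suff fcvg (A : fellH G) : f B @[B --> A] --> f A by [].
apply: (fellH_cvgP (fmap_filter f (nbhs_filter A))) => [V oV [y []]|Q Qco].
  rewrite fE => -[a Aa <-] Va.
  have oV' : open (i @^-1` V) by move/continuousP: topG.2; exact.
  have : nbhs A (hit (i @^-1` V)).
    by apply: open_nbhs_nbhs; split; [exact: hit_open|exists a].
  apply: (@filterS _ (nbhs A)) => B [b [Bb Vb]]; exists (i b); rewrite fE.
  by split=> //; exists b.
have missI B : miss Q (f B) <-> miss Q^! B.
  rewrite !missE; split=> nh [b [Bb Qb]]; apply: nh.
    case: Qb => q Qq qb; exists q; split=> //; rewrite fE.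
    by exists b => //; rewrite -qb ginvK.
  move: Bb; rewrite fE => -[c Bc cb]; exists c; split=> //.
  by exists b => //; rewrite -cb ginvK.
move=> /missI QA; have : nbhs A (miss Q^!).
  by apply: open_nbhs_nbhs; split=> //; apply: miss_open; exact: set_inv_compact.
by apply: (@filterS _ (nbhs A)) => B /missI.
Qed.

(** That [f A B] avoiding [Q] is stable near [(A, B)] is proved by contradiction:
    an ultrafilter [U] of pairs close to [(A, B)] whose products meet [Q] yields, by
    quasi-compactness, a point [q] of [Q] that is a limit of elements of the
    products, and [q = a (a^-1 q)] belongs to [AB]. *)
Lemma fell_mul_continuous (D : set (fellH G * fellH G))
    (f : fellH G -> fellH G -> fellH G) :
  (forall A B, D (A, B) -> [A]^! ** [A] = [B] ** [B]^!) ->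
  (forall A B, D (A, B) -> [f A B] = [A] ** [B]) ->
  {within D, continuous (fun p => f p.1 p.2)}.
Proof.
move=> Dcomp fE; apply/subspace_continuousP => -[A B] DAB /=.
have near_hit C V x : open_nbhs x V -> [C] x -> nbhs C (hit V).
  by move=> [oV Vx] Cx; apply: open_nbhs_nbhs; split; [exact: hit_open|exists x].
set N := nbhs (A, B); have NF : Filter N := nbhs_filter (A, B).
have hitA V a : nbhs a V -> [A] a -> N [set p | exists2 x, [p.1] x & V x].
  rewrite nbhsE => -[O [oO Oa] OV] Aa.
  exists (hit O, setT); first by split; [exact: near_hit Aa|exact: filterT].
  by move=> [A' B'] [/= [x [A'x Ox]] _]; exists x => //; exact: OV.
have hitB V b : nbhs b V -> [B] b -> N [set p | exists2 x, [p.2] x & V x].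
  rewrite nbhsE => -[O [oO Ob] OV] Bb.
  exists (setT, hit O); first by split; [exact: filterT|exact: near_hit Bb].
  by move=> [A' B'] [_ /= [x [B'x Ox]]]; exists x => //; exact: OV.
apply: fellH_cvgP => [V oV [z []]|Q Qco].
  rewrite fE // => -[a [b [Aa Bb ab ->]]] Vab.
  have nV : nbhs (m a b) V by exact: open_nbhs_nbhs.
  have [V1 [V2 [nV1 nV2 VV]]] := gmul_nbhs topG ab nV.
  suff : N [set p | D p -> hit V (f p.1 p.2)] by [].
  apply: filterS (filterI (hitA _ _ nV1 Aa) (hitB _ _ nV2 Bb)).
  move=> [A' B'] [[/= x Ax V1x] [y By V2y]] DAB'.
  have xy : s x = r y by apply: (fell_comp (Dcomp _ _ DAB')).
  exists (m x y); split; last exact: VV.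
  by rewrite fE //; exists x, y.
move=> QAB; apply: contrapT => nQ.
have [U [UU NU UnQ]] := ultra_refine (within_filter D NF) nQ.
have UD : U D by apply: NU; exact: withinT.
have {}NU S : N S -> U S by move=> NS; apply: NU; exact: cvg_within NS.
have [a Aa] := fellH_neq0 A.
(* The default value [a] is taken only where the product of the pair does not
   meet [Q], which happens for no pair in some set of [U]. *)
pose c (p : fellH G * fellH G) := xget a (([p.1] ** [p.2]) `&` Q).
have cP : U [set p | (([p.1] ** [p.2]) `&` Q) (c p)].
  apply: filterS (filterI UD UnQ) => -[A' B'] [DAB' nm].
  move: nm; rewrite /= missE => /contrapT; rewrite /hit /= fE //.
  exact: xgetPex.
have CU := fmap_ultra c UU.
have [|q Qq cq] := (cover_compactP _).1 Qco _ CU.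
  by apply: (@filterS _ U) cP => p [].
have rq : r a = r q.
  apply: (@unit_cvg_unique _ _ hausG0 (r (c p) @[p --> U])); last exact: grng_cvg.
  move=> W nW; have nrW : nbhs a (r @^-1` W).
    exact: (@grng_cvg _ _ topG _ (nbhs a) id a _ cvg_id).
  suff : U [set p | W (r (c p))] by [].
  apply: filterS (filterI cP (NU _ (hitA _ _ nrW Aa))) => p.
  move=> [[[x [y [px py xy cE]]] _] [x' px' Wx']].
  by rewrite /= cE grng_mul // (fell_grng px px').
have siaq : s (i a) = r q by rewrite gsrc_inv.
(* Otherwise some quasi-compact neighbourhood [K] of [a^-1 q] misses [B], hence
   misses [B'] for the pairs [(A', B')] close to [(A, B)]; but [B'] contains
   [x^-1 c(A', B')] for [x] in [A'] close to [a]. *)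
have Bq : [B] (m (i a) q).
  apply: contrapT => /(fellH_separate lcG) [K [Kco nK KB]].
  have [V1 [V2 [nV1 nV2 VK]]] := gmul_nbhs topG siaq nK.
  have nV1' : nbhs a (i @^-1` V1) by exact: topG.2.
  have UK : U [set p | miss K p.2].
    apply: NU; exists (setT, miss K); last by move=> p [].
    split; first exact: filterT.
    by apply: open_nbhs_nbhs; split=> //; exact: miss_open.
  have UV2 : U [set p | V2 (c p)] := cq _ nV2.
  have [[A' B'] [DAB' [[/= x A'x V1x] [[cAB' _] [V2c]]]]] := filter_ex
    (filterI UD (filterI (NU _ (hitA _ _ nV1' Aa)) (filterI cP (filterI UV2 UK)))).
  rewrite missE /=; apply; exists (m (i x) (c (A', B'))).
  have cE : [A']^! ** ([A'] ** [B']) = [B'].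
    have [B'' B''E] := fell_inv_ex B'.
    rewrite set_mulA (Dcomp _ _ DAB') -set_mulA.
    exact: fell_mulVK.
  have src : s (i x) = r (c (A', B')).
    have [x' [y' [A'x' B'y' xy' ->]]] := cAB'.
    by rewrite gsrc_inv grng_mul // (fell_grng A'x A'x').
  split; last exact: VK.
  by rewrite -cE; exists (i x), (c (A', B')); split=> //; exists x.
move: QAB; rewrite missE; apply; exists q; split=> //; rewrite /= fE //.
exists a, (m (i a) q); split=> //.
  by rewrite grng_mul // grng_inv.
by rewrite gmulVKl.
Qed.

End FellGroupoid.

Theorem theorem2p2 (G : topologicalType) (g : groupoid G)
  (topG : topological_groupoid g)
  (lcG : locally_compact_space G)
  (hausG0 : hausdorff_space (set_type (gunits g)))
  (open_rng : open_map (grng g))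
  (open_src : open_map (gsrc g)) :
  exists h : groupoid (fellH G),
    [/\ topological_groupoid h,
        locally_compact_space (fellH G),
        hausdorff_space (fellH G),
        gunits h = closure (fellH_point lcG @` gunits g) &
        [/\ (forall A : fellH G,
               fellH_set (set_val (grng h A)) =
               set_mul g (fellH_set A) (set_inv g (fellH_set A))),
            (forall A : fellH G,
               fellH_set (set_val (gsrc h A)) =
               set_mul g (set_inv g (fellH_set A)) (fellH_set A)),
            (forall A B : fellH G, gsrc h A = grng h B ->
               fellH_set (gmul h A B) =
               set_mul g (fellH_set A) (fellH_set B)) &
            (forall A : fellH G,
               fellH_set (ginv h A) = set_inv g (fellH_set A))]].
Proof.
have [R RE] := choice (fell_rng_ex topG lcG hausG0).
have [S SE] := choice (fell_src_ex topG lcG hausG0).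
have [I IE] := choice (fell_inv_ex topG).
have SRE A B : S A = R B <-> set_mul g (set_inv g (fellH_set A)) (fellH_set A) =
    set_mul g (fellH_set B) (set_inv g (fellH_set B)).
  rewrite -SE -RE; split=> [->//|SR].
  by apply: val_inj; exact: fellH_set_inj.
have /choice[M ME'] : forall p : fellH G * fellH G, exists C, S p.1 = R p.2 ->
    fellH_set C = set_mul g (fellH_set p.1) (fellH_set p.2).
  move=> [A B] /=; have [/SRE AB|nAB] := pselect (S A = R B).
    by have [C CE] := fell_mul_ex topG hausG0 open_rng AB; exists C.
  (* Outside the composable pairs the value is arbitrary. *)
  by exists A.
have ME A B : S A = R B ->
    fellH_set (M (A, B)) = set_mul g (fellH_set A) (fellH_set B).
  exact: (ME' (A, B)).
have mulVK := fell_mulVK topG hausG0.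
have R_unit U : R (set_val U) = U.
  apply: val_inj; apply: fellH_set_inj; rewrite RE.
  exact: (fell_unit_rng topG hausG0 (set_valP U)).
have S_unit U : S (set_val U) = U.
  apply: val_inj; apply: fellH_set_inj; rewrite SE.
  rewrite (fell_unit_inv topG hausG0 (set_valP U)).
  rewrite -{2}(fell_unit_inv topG hausG0 (set_valP U)).
  exact: (fell_unit_rng topG hausG0 (set_valP U)).
have R_mul A B : S A = R B -> R (M (A, B)) = R A.
  move=> AB; apply: val_inj; apply: fellH_set_inj; rewrite !RE ME // set_invM.
  rewrite -set_mulA (set_mulA g (fellH_set B)) -((SRE _ _).1 AB) set_mulA.
  by rewrite mulVK.
have S_mul A B : S A = R B -> S (M (A, B)) = S B.
  move=> AB; apply: val_inj; apply: fellH_set_inj; rewrite !SE ME // set_invM.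
  rewrite -set_mulA (set_mulA g _ (fellH_set A)) ((SRE _ _).1 AB).
  by rewrite -(set_mulA g (fellH_set B)) mulVK.
have M_assoc A B C : S A = R B -> S B = R C ->
    M (A, M (B, C)) = M (M (A, B), C).
  move=> AB BC; apply: fellH_set_inj; rewrite ME ?R_mul // ME // ME ?S_mul // ME //.
  exact: set_mulA.
have M_rng A : M (set_val (R A), A) = A.
  by apply: fellH_set_inj; rewrite ME ?S_unit // RE -set_mulA mulVK.
have M_src A : M (A, set_val (S A)) = A.
  by apply: fellH_set_inj; rewrite ME ?R_unit // SE mulVK.
have R_inv A : R (I A) = S A.
  by apply: val_inj; apply: fellH_set_inj; rewrite RE SE IE set_invK.
have S_inv A : S (I A) = R A.
  by apply: val_inj; apply: fellH_set_inj; rewrite RE SE IE set_invK.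
have M_invr A : M (A, I A) = set_val (R A).
  by apply: fellH_set_inj; rewrite ME ?R_inv // RE IE.
have M_invl A : M (I A, A) = set_val (S A).
  by apply: fellH_set_inj; rewrite ME ?S_inv // SE IE.
exists (@Groupoid _ _ R S (fun A B => M (A, B)) I R_unit S_unit R_mul S_mul
  M_assoc M_rng M_src R_inv S_inv M_invr M_invl).
split=> //; [split|exact: fellH_locally_compact|exact: fellH_hausdorff].
- by apply: (fell_mul_continuous topG lcG hausG0 (f := fun A B => M (A, B))) => A B;
    [move=> /SRE|move=> /ME].
- exact: fell_inv_continuous IE.
Qed.
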